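(* Let $\mathcal B$ be the $\sigma$-algebra of subsets of the Cantor space $\{0,1\}^{\mathbb N}$ with the Baire property and $\mathcal M$ the $\sigma$-ideal of meager subsets of $\{0,1\}^{\mathbb N}$. Let $\Phi_{\mathcal M}$ assign to each set $A\in\mathcal B$ the set of all $\mathcal M$-density points of $A$. Then $\Phi_{\mathcal M}\colon\mathcal B\to\mathcal B$ is a lower density operator with respect to $\mathcal M$, and its values are $F_{\sigma\delta}$ sets, i.e. sets of class $\mathbf{\Pi}^0_3$, in $\{0,1\}^{\mathbb N}$.
   Context: $\mathbb{N}$ is the set of positive integers, and $\{0,1\}^{\mathbb N}$ carries the product topology of discrete spaces. Lower density operator: let $\Sigma$ be a $\sigma$-algebra of subsets of a nonempty set $X$ and let $J\subset\Sigma$ be a $\sigma$-ideal. Write $A\sim B$ if $A\bigtriangleup B\in J$. A mapping $\Phi\colon\Sigma\to\Sigma$ is a lower density operator with respect to $J$ if: (i) $\Phi(X)=X$ and $\Phi(\emptyset)=\emptyset$; (ii) $A\sim B$ implies $\Phi(A)=\Phi(B)$ for all $A,B\in\Sigma$; (iii) $A\sim\Phi(A)$ for every $A\in\Sigma$; (iv) $\Phi(A\cap B)=\Phi(A)\cap\Phi(B)$ for all $A,B\in\Sigma$. Here $X=\{0,1\}^{\mathbb N}$, $\Sigma=\mathcal B$ and $J=\mathcal M$. Regular open kernel: every $A\in\mathcal B$ can be uniquely expressed as $A=G\bigtriangleup E$ with $G$ regular open (that is, $G=\operatorname{int}(\operatorname{cl}G)$) and $E\in\mathcal M$; this $G$ is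 denoted $\widetilde{A}$ and called the regular open kernel of $A$. For a finite sequence $s$ of zeros and ones, $U(s)=\{x\in\{0,1\}^{\mathbb N}: s\subseteq x\}$ is the set of all $x$ having $s$ as an initial segment. For $x\in\{0,1\}^{\mathbb N}$, $x|\ell$ is the restriction of $x$ to its first $\ell$ terms. For finite sequences $s,t$, $s\frown t$ is their concatenation (the terms of $t$ follow the terms of $s$). $\mathcal M$-density points: a point $x\in\{0,1\}^{\mathbb N}$ is an $\mathcal M$-dispersion point of $A\in\mathcal B$ if for each $n\in\mathbb N$ there exists $k\in\mathbb N$ such that for each $\ell\in\mathbb N$ with $\ell>k$ and every $s\in\{0,1\}^n$ there exists $t\in\{0,1\}^k$ with $\widetilde{A}\cap U((x|\ell)\frown s\frown t)=\emptyset$. A point $x$ is an $\mathcal M$-density point of $A\in\mathcal B$ if it is an $\mathcal M$-dispersion point of the complement $A^c=\{0,1\}^{\mathbb N}\setminus A$. A set is of type $F_{\sigma\delta}$ (class $\mathbf{\Pi}^0_3$) if it is a countable intersection of $F_\sigma$ sets, i.e. of countable unions of closed sets. *)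

(* Defs.v *)
From HB Require Import structures.
From mathcomp Require Import all_boot all_order all_algebra.
From mathcomp Require Import all_classical all_reals all_analysis borel_hierarchy.

Set Implicit Arguments.
Unset Strict Implicit.
Unset Printing Implicit Defensive.

Local Open Scope classical_set_scope.

Definition sigma_ideal (T : Type) (J : set (set T)) :=
  [/\ J set0, (forall A B, A `<=` B -> J B -> J A) &
      (forall F : (set T)^nat, (forall n, J (F n)) -> J (\bigcup_n F n))].

(* [Phi] is a total function on [set T]; only its values on [Sigma] matter.
   The standing assumptions on the nonempty set T (a pointed type), the
   sigma-algebra [Sigma] and the sigma-ideal [J] are part of the notion. *)
Record lower_density_operator (T : pointedType) (Sigma J : set (set T))
    (Phi : set T -> set T) : Prop := LowerDensityOperator {
  ldo_sigma_algebra : sigma_algebra setT Sigma;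
  ldo_sigma_ideal : sigma_ideal J;
  ldo_ideal_sub : J `<=` Sigma;
  ldo_maps : forall A, Sigma A -> Sigma (Phi A);
  ldo_setT : Phi setT = setT;
  ldo_set0 : Phi set0 = set0;
  ldo_equiv : forall A B, Sigma A -> Sigma B -> J (A `+` B) -> Phi A = Phi B;
  ldo_sim : forall A, Sigma A -> J (A `+` Phi A);
  ldo_setI : forall A B, Sigma A -> Sigma B ->
    Phi (A `&` B) = Phi A `&` Phi B
}.

Section baire_category.
Context {T : topologicalType}.
Implicit Types A E G S : set T.

Definition nowhere_dense A := interior (closure A) = set0.

Definition meager A :=
  exists2 F : (set T)^nat, (forall n, nowhere_dense (F n)) & A = \bigcup_n F n.

Definition baire_property A :=
  exists G E, [/\ open G, meager E & A = G `+` E].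

(* In a Baire space, such as the Cantor space, every set with the Baire
   property has exactly one such G; [set0] is the default value for the other
   sets. *)
Definition regular_open_kernel A : set T :=
  xget set0 [set G | regopen G /\ exists2 E, meager E & A = G `+` E].

Definition Fsigmadelta S :=
  exists2 F : (set T)^nat, (forall n, Fsigma (F n)) & S = \bigcap_n F n.

End baire_category.

(* Coordinates are indexed from 0: the first [l] terms of x are
   x 0, ..., x l.-1. *)
Definition initial_segment (x : cantor_space) (l : nat) : seq bool := mkseq x l.

Definition cylinder (s : seq bool) : set cantor_space :=
  [set x | initial_segment x (size s) = s].

Definition M_dispersion_point (A : set cantor_space) (x : cantor_space) :=
  forall n : nat, (0 < n)%N -> exists2 k : nat, (0 < k)%N &
    forall l : nat, (k < l)%N -> forall s : n.-tuple bool,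
      exists t : k.-tuple bool,
        regular_open_kernel A `&` cylinder (initial_segment x l ++ s ++ t)
          = set0.

Definition M_density_point (A : set cantor_space) (x : cantor_space) :=
  M_dispersion_point (~` A) x.

Definition Phi_M (A : set cantor_space) : set cantor_space :=
  [set x | M_density_point A x].

(* Main.v *)
(** By the Baire category theorem, the regular open kernel of A misses an open
    set U iff A `&` U is meager, so dispersion points can be tested with
    "meager" in place of kernels. This makes dispersion monotone modulo meager
    sets. A union of two sets is handled by concatenating the two words t.
    If A differs from an open set G by a meager set, then every point of G is a
    density point of A and no point of the exterior of G is one, so A and
    Phi_M A differ by a meager set, the boundary of G being nowhere dense.
    Finally, for fixed n, k, l the defining condition depends only on the first
    l terms of x, hence defines a clopen set, and the quantifiers
    "for all n, exists k, for all l" give an F_sigma_delta set. *)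
Require Import Defs.
From mathcomp Require Import all_boot all_order all_algebra.
From mathcomp Require Import all_classical all_reals all_analysis borel_hierarchy.

Set Implicit Arguments.
Unset Strict Implicit.
Unset Printing Implicit Defensive.

Local Open Scope classical_set_scope.

(** * Symmetric differences *)

Lemma subset_bigcup_setY {I T : Type} (F G : I -> set T) :
  \bigcup_i F i `+` \bigcup_i G i `<=` \bigcup_i (F i `+` G i).
Proof.
move=> x [[[i _ Fx] nGx]|[[i _ Gx] nFx]]; exists i => //.
  by left; split=> // Gx; apply: nGx; exists i.
by right; split=> // Fx; apply: nFx; exists i.
Qed.

Lemma setYCC {T : Type} (A B : set T) : ~` A `+` ~` B = A `+` B.
Proof.
by rewrite -!setYTC -setYA (setYA setT) (setYC setT B) -setYA setYK setY0.
Qed.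

Lemma setYKl {T : Type} (A B : set T) : A `+` (A `+` B) = B.
Proof. by rewrite setYA setYK set0Y. Qed.

(** * Meager sets, the Baire property and regular open kernels *)

Section baire_category.
Context {T : topologicalType}.
Implicit Types A B G U : set T.

Lemma nowhere_dense0 : nowhere_dense (@set0 T).
Proof. by rewrite /nowhere_dense closure0 interior0. Qed.

Lemma nowhere_denseS A B : A `<=` B -> nowhere_dense B -> nowhere_dense A.
Proof.
move=> /closureS/interiorS AB B0; apply/seteqP; split=> // x /AB.
by rewrite B0.
Qed.

(** The difference is closed, and its interior lies both in [G°] and outside the closure of [G°].
    Applied to the complement of an open set, this handles the frontier of that open set. *)
Lemma nowhere_dense_closedD G : closed G -> nowhere_dense (G `\` G°).
Proof.
move=> cG; have cD : closed (G `\` G°).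
  rewrite setDE; apply: closedI => //; apply: open_closedC.
  exact: open_interior.
rewrite /nowhere_dense -(closure_id _).1// setDE interiorI interiorC.
rewrite -subset0 => x [Gx]; apply; exact: subset_closure.
Qed.

Lemma nowhere_dense_meager A : nowhere_dense A -> meager A.
Proof. by move=> Am; exists (fun=> A) => //; rewrite bigcup_const. Qed.

Lemma meager0 : meager (@set0 T).
Proof. exact/nowhere_dense_meager/nowhere_dense0. Qed.

Lemma meagerS A B : A `<=` B -> meager B -> meager A.
Proof.
move=> AB [F Fm BF]; exists (fun n => A `&` F n) => [n|].
  by apply: nowhere_denseS (Fm n); exact: subIsetr.
by rewrite -setI_bigcupr -BF; apply/esym/setIidPl.
Qed.

Lemma meager_bigcup (F : (set T)^nat) :
  (forall n, meager (F n)) -> meager (\bigcup_n F n).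
Proof.
move=> Fm; have /choice[H HP] : forall n, exists H : (set T)^nat,
    (forall m, nowhere_dense (H m)) /\ F n = \bigcup_m H m.
  by move=> n; have [H Hm FH] := Fm n; exists H.
(* The double family is enumerated through codes of pairs; numbers coding no pair contribute the
   empty set. *)
exists (fun k => if unpickle k is Some (n, m) then H n m else set0) => [k|].
  by case: unpickle => [[n m]|]; [exact: (HP n).1 | exact: nowhere_dense0].
apply/seteqP; split=> [x [n _]|x [k _]].
  by rewrite (HP n).2 => -[m _ Hx]; exists (pickle (n, m)) => //; rewrite pickleK.
case: unpickle => [[n m] Hx|//]; exists n => //.
by rewrite (HP n).2; exists m.
Qed.

Lemma meager_sigma_ideal : sigma_ideal (@meager T).
Proof. by split; [exact: meager0 | exact: meagerS | exact: meager_bigcup]. Qed.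

Lemma meagerU A B : meager A -> meager B -> meager (A `|` B).
Proof.
move=> Am Bm; rewrite -bigcup2E; apply: meager_bigcup => -[|[|n]] //=.
exact: meager0.
Qed.

Lemma meager_setY_trans A B G :
  meager (A `+` B) -> meager (B `+` G) -> meager (A `+` G).
Proof.
move=> AB BG; apply: meagerS (meagerU AB BG) => x /=.
by case: (pselect (B x)); tauto.
Qed.

Lemma baire_propertyP A :
  baire_property A <-> exists2 G, open G & meager (A `+` G).
Proof.
split=> [[G [E [oG Em ->]]]|[G oG AG]].
  by exists G => //; rewrite setYC setYKl.
by exists G, (G `+` A); rewrite setYKl setYC.
Qed.

Lemma baire_property_meager_setY A B :
  meager (A `+` B) -> baire_property B -> baire_property A.
Proof.
move=> AB /baire_propertyP[G oG BG]; apply/baire_propertyP; exists G => //.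
exact: meager_setY_trans BG.
Qed.

Lemma baire_property_open G : open G -> baire_property G.
Proof.
move=> oG; apply/baire_propertyP; exists G => //.
by rewrite setYK; exact: meager0.
Qed.

Lemma baire_property_closed G : closed G -> baire_property G.
Proof.
move=> cG; apply/baire_propertyP; exists G°; first exact: open_interior.
apply: meagerS (nowhere_dense_meager (nowhere_dense_closedD cG)) => x.
by case=> // -[+ nGx] => /interior_subset.
Qed.

Lemma baire_property_meager A : meager A -> baire_property A.
Proof.
move=> Am; apply: (@baire_property_meager_setY _ set0); first by rewrite setY0.
exact/baire_property_open/open0.
Qed.

(** Complementation preserves symmetric differences, so an open approximation of [A] becomes a
    closed one of its complement. *)
Lemma baire_propertyC A : baire_property A -> baire_property (~` A).
Proof.
move=> /baire_propertyP[G oG AG]; apply: (@baire_property_meager_setY _ (~` G)).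
  by rewrite setYCC.
exact/baire_property_closed/open_closedC.
Qed.

Lemma baire_property_bigcup (F : (set T)^nat) :
  (forall n, baire_property (F n)) -> baire_property (\bigcup_n F n).
Proof.
move=> FB; have /choice[G GP] : forall n, exists G, open G /\ meager (F n `+` G).
  by move=> n; have /baire_propertyP[G] := FB n; exists G.
apply: (@baire_property_meager_setY _ (\bigcup_n G n)).
  apply: meagerS (@subset_bigcup_setY _ _ F G) _.
  by apply: meager_bigcup => n; exact: (GP n).2.
by apply/baire_property_open/bigcup_open => n _; exact: (GP n).1.
Qed.

Lemma baire_propertyU A B :
  baire_property A -> baire_property B -> baire_property (A `|` B).
Proof.
move=> Ab Bb; rewrite -bigcup2E; apply: baire_property_bigcup => -[|[|n]] //=.
exact/baire_property_meager/meager0.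
Qed.

Lemma baire_property_sigma_algebra : sigma_algebra setT (@baire_property T).
Proof.
split=> [|A|]; last exact: baire_property_bigcup.
  exact/baire_property_meager/meager0.
by rewrite setTD; exact: baire_propertyC.
Qed.

Lemma regular_open_kernelP A : baire_property A ->
  regopen (regular_open_kernel A) /\ meager (A `+` regular_open_kernel A).
Proof.
move=> /baire_propertyP[G oG AG].
suff /xgetPex-/(_ set0)[/= roG [E Em]] : exists G', regopen G' /\
    exists2 E, meager E & A = G' `+` E.
  rewrite -/(regular_open_kernel A) => AE; split=> //.
  suff -> : A `+` regular_open_kernel A = E by [].
  by rewrite setYC -[RHS](setYKl (regular_open_kernel A)) -AE.
(* Passing from [G] to the interior of its closure only adds points of the frontier of [G], which is
   nowhere dense. *)
exists (closure G)°; split; first exact/interior_closed_regopen/closed_closure.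
exists ((closure G)° `+` A); last by rewrite setYKl.
rewrite setYC; apply: (@meager_setY_trans _ G) => //.
have clG := nowhere_dense_meager (nowhere_dense_closedD (open_closedC oG)).
apply: meagerS clG => x; rewrite interiorC setDE setCK.
case=> -[Gx nGx]; last first.
  by split=> //; exact: interior_subset.
case: nGx; suff : G `<=` (closure G)° by apply.
by rewrite -open_subsetE//; exact: subset_closure.
Qed.

End baire_category.

(** * Cylinders and the topology of the Cantor space *)

Implicit Types (A B : set cantor_space) (x y : cantor_space) (s t : seq bool).

Lemma cylinderP s x :
  cylinder s x <-> forall i, i < size s -> x i = nth false s i.
Proof.
split=> [sx i lt_is|sx]; first by rewrite -[in RHS]sx nth_mkseq.
apply: (@eq_from_nth _ false); rewrite size_mkseq// => i lt_is.
by rewrite nth_mkseq// sx.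
Qed.

Lemma cylinder_catl s t : cylinder (s ++ t) `<=` cylinder s.
Proof.
move=> x /cylinderP stx; apply/cylinderP => i lt_is.
by rewrite stx ?nth_cat ?lt_is// size_cat ltn_addr.
Qed.

Lemma cylinder_initial_segment x l : cylinder (initial_segment x l) x.
Proof. by rewrite /cylinder /= size_mkseq. Qed.

Lemma cylinder_nonempty s : cylinder s !=set0.
Proof. by exists (fun i => nth false s i); apply/cylinderP. Qed.

Lemma initial_segment_cat x s l : cylinder s x -> size s <= l ->
  exists t, initial_segment x l = s ++ t.
Proof.
move=> sx le_sl; exists (drop (size s) (initial_segment x l)).
rewrite -[LHS](cat_take_drop (size s)); congr (_ ++ _).
apply: (@eq_from_nth _ false) => [|i].
  by rewrite size_take_min size_mkseq; apply/minn_idPl.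
rewrite size_take_min size_mkseq leq_min => /andP[lt_is lt_il].
by rewrite nth_take// nth_mkseq//; move/cylinderP: sx; apply.
Qed.

Lemma initial_segmentS x l m : l <= m ->
  cylinder (initial_segment x m) `<=` cylinder (initial_segment x l).
Proof.
move=> le_lm; have [||t ->] := @initial_segment_cat x (initial_segment x l) m.
- exact: cylinder_initial_segment.
- by rewrite size_mkseq.
exact: cylinder_catl.
Qed.

Lemma open_cylinder s : open (cylinder s).
Proof.
elim/last_ind: s => [|s b IHs].
  suff -> : cylinder [::] = setT by exact: openT.
  by rewrite -subTset.
suff -> : cylinder (rcons s b) =
    cylinder s `&` proj (size s) @^-1` [set b].
  apply: openI => //; apply: open_comp; last exact: discrete_open.
  by move=> x _; exact: proj_continuous.
apply/seteqP; split=> [x sbx|x [/cylinderP sx sb]].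
  split; first by move: sbx; rewrite -cats1; exact: cylinder_catl.
  move/cylinderP: sbx => /(_ (size s)); rewrite size_rcons => /(_ (ltnSn _)).
  by rewrite nth_rcons ltnn eqxx.
apply/cylinderP => i; rewrite size_rcons ltnS nth_rcons.
by case: ltngtP => // [/sx//|->].
Qed.

Lemma nbhs_cylinder x (U : set cantor_space) :
  nbhs x U -> exists l, cylinder (initial_segment x l) `<=` U.
Proof.
pose F := filter_from [set: nat] (fun l => cylinder (initial_segment x l)).
have FF : Filter F.
  apply: filter_from_filter; first by exists 0.
  move=> i j _ _; exists (maxn i j) => //; rewrite subsetI.
  by split; apply: initial_segmentS; rewrite ?leq_maxl ?leq_maxr.
suff Fx : F --> x by move=> /Fx[l _]; exists l.
(* The product topology is a supremum over coordinates, so convergence is checked one coordinate at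
   a time; a segment of length [i.+1] fixes coordinate [i]. *)
apply/cvg_sup => i U'.
move=> [V] [[W] oW <-] Wx WU; exists i.+1 => // y yx.
apply: WU; rewrite /= (_ : y i = x i)//.
by move/cylinderP: yx => /(_ i); rewrite size_mkseq nth_mkseq//; exact.
Qed.

Lemma open_initial_segment (P : set (seq bool)) l :
  open [set x | P (initial_segment x l)].
Proof.
rewrite openE => x Px; apply: (@filterS _ _ _ (cylinder (initial_segment x l))).
  by move=> y; rewrite /cylinder /= size_mkseq => ->.
apply: open_nbhs_nbhs; split; first exact: open_cylinder.
exact: cylinder_initial_segment.
Qed.

Lemma closed_initial_segment (P : set (seq bool)) l :
  closed [set x | P (initial_segment x l)].
Proof. by rewrite -openC; exact: (open_initial_segment (~` P)). Qed.

(** * The Baire category theorem for the Cantor space *)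

Lemma nowhere_dense_cylinder (F : set cantor_space) s : nowhere_dense F ->
  exists t, 0 < size t /\ cylinder (s ++ t) `&` F = set0.
Proof.
move=> F0; have [y [sy nFy]] : (cylinder s `\` closure F) !=set0.
  apply/set0P/eqP; rewrite setD_eq0.
  rewrite open_subsetE; last exact: open_cylinder.
  by move=> sF; have [y /sF] := cylinder_nonempty s; rewrite F0.
have [l lF] : exists l, cylinder (initial_segment y l) `<=` ~` closure F.
  apply: nbhs_cylinder; apply: open_nbhs_nbhs; split=> //.
  exact/closed_openC/closed_closure.
(* The segment of [y] is long enough both to avoid [F] and to extend [s] properly. *)
have [|t yt] := @initial_segment_cat y s (maxn l (size s).+1) sy.
  by rewrite leq_max leqnSn orbT.
exists t; split.
  rewrite -(ltn_add2l (size s)) addn0 -size_cat -yt size_mkseq.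
  by rewrite leq_max leqnn orbT.
rewrite -yt -subset0 => z [/(initial_segmentS (leq_maxl _ _))/lF nFz Fz].
by apply: nFz; exact: subset_closure.
Qed.

Lemma cylinder_not_meager s : ~ meager (cylinder s).
Proof.
move=> [F Fm sF].
have /choice[g gP] : forall p : nat * seq bool, exists t,
    0 < size t /\ cylinder (p.2 ++ t) `&` F p.1 = set0.
  by move=> p; exact: nowhere_dense_cylinder.
(* Step [m] extends the current word so that its cylinder misses [F m]; the limit of these words is
   a point of [cylinder s] outside every [F m]. *)
pose q := fix q n := if n is m.+1 then q m ++ g (m, q m) else s.
have size_q n : n <= size (q n).
  elim: n => // n IHn /=; rewrite size_cat -addn1 leq_add//.
  exact: (gP (n, q n)).1.
have qq n m : n <= m -> exists t, q m = q n ++ t.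
  move=> /subnKC <-; elim: (m - n) => [|d [t IHd]].
    by exists [::]; rewrite addn0 cats0.
  by rewrite addnS /= IHd -catA; eexists.
(* [q i.+1] has more than [i] letters, so the default [false] is never read. *)
pose x : cantor_space := fun i => nth false (q i.+1) i.
have qx n : cylinder (q n) x.
  apply/cylinderP => i lt_in; rewrite /x.
  have [/qq[t ->]|/ltnW/qq[t ->]] := leqP n i.+1; rewrite nth_cat ?lt_in//.
  by rewrite size_q.
have : cylinder s x by exact: (qx 0).
rewrite sF => -[n _ Fx]; have /seteqP[+ _] := (gP (n, q n)).2.
by move=> /(_ x); apply; split=> //; exact: (qx n.+1).
Qed.

Lemma meager_open_eq0 (U : set cantor_space) : open U -> meager U -> U = set0.
Proof.
rewrite openE => oU Um; rewrite -subset0 => x /oU/nbhs_cylinder[l lU].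
by have /cylinder_not_meager := meagerS lU Um.
Qed.

(** * Dispersion points tested by meager sets *)

Lemma regular_open_kernel_disjoint A (U : set cantor_space) :
  baire_property A -> open U ->
  regular_open_kernel A `&` U = set0 <-> meager (A `&` U).
Proof.
move=> /regular_open_kernelP[rG AG] oU; split=> [GU|AU].
  apply: meagerS AG => x [Ax Ux]; left; split=> // Gx.
  by move/seteqP: GU => [/(_ x) + _]; apply.
(* The kernel meets [U] in an open set, which is covered by two meager sets and hence empty. *)
apply: meager_open_eq0.
  by apply: openI => //; rewrite -rG; exact: open_interior.
apply: meagerS (meagerU AG AU) => x [Gx Ux] /=.
by case: (pselect (A x)) => Ax; [right | left; right].
Qed.

Lemma M_dispersion_pointP A x : baire_property A ->
  M_dispersion_point A x <->
  forall n, 0 < n -> exists2 k, 0 < k & forall l, k < l ->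
    forall s : n.-tuple bool, exists t : k.-tuple bool,
      meager (A `&` cylinder (initial_segment x l ++ s ++ t)).
Proof.
move=> Ab; have H s := regular_open_kernel_disjoint Ab (open_cylinder s).
by split=> Ax n /Ax[k k0 kP]; exists k => // l /kP + s => /(_ s)[t /H];
  exists t.
Qed.

Lemma M_dispersion_pointS A B x : baire_property A -> baire_property B ->
  meager (A `\` B) -> M_dispersion_point B x -> M_dispersion_point A x.
Proof.
move=> Ab Bb AB /(M_dispersion_pointP _ Bb) Bx; apply/M_dispersion_pointP => //.
move=> n /Bx[k k0 kP]; exists k => // l /kP + s => /(_ s)[t Bm]; exists t.
apply: meagerS (meagerU AB Bm) => y [Ay ty] /=.
by case: (pselect (B y)); tauto.
Qed.

(* If k works for (A, n) and m works for (B, n + k), then k + m works for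
   (A `|` B, n). *)
Lemma M_dispersion_pointU A B x : baire_property A -> baire_property B ->
  M_dispersion_point A x -> M_dispersion_point B x ->
  M_dispersion_point (A `|` B) x.
Proof.
move=> Ab Bb /(M_dispersion_pointP _ Ab) Ax /(M_dispersion_pointP _ Bb) Bx.
apply/M_dispersion_pointP; first exact: baire_propertyU.
move=> n n0; have [k k0 kP] := Ax _ n0.
have [m m0 mP] := Bx (n + k) (ltn_addr _ n0).
exists (k + m) => [|l lt_kml s]; first exact: ltn_addr.
have [t At] := kP _ (leq_ltn_trans (leq_addr _ _) lt_kml) s.
have [u Bu] := mP _ (leq_ltn_trans (leq_addl _ _) lt_kml) [tuple of s ++ t].
exists [tuple of t ++ u]; move: Bu; rewrite /= -(catA s) => Bu.
apply: meagerS (meagerU At Bu) => y [[Ay|By] ty]; last by right.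
by left; split=> //; move: ty; rewrite (catA s) catA; exact: cylinder_catl.
Qed.

Lemma meager_M_dispersion_point A x : meager A -> M_dispersion_point A x.
Proof.
move=> Am; apply/M_dispersion_pointP; first exact: baire_property_meager.
move=> n _; exists 1 => // l _ s; exists [tuple false].
by apply: meagerS Am; exact: subIsetl.
Qed.

Lemma nbhs_M_dispersion_point A x (U : set cantor_space) : baire_property A ->
  nbhs x U -> meager (A `&` U) -> M_dispersion_point A x.
Proof.
move=> Ab /nbhs_cylinder[l lU] AU; apply/M_dispersion_pointP => // n _.
(* Any [k] that is positive and at least [l] would do: the segment of length [m] already forces the
   cylinder into [U], whatever the word [t]. *)
exists l.+1 => // m lt_lm s; exists [tuple of nseq l.+1 false].
apply: meagerS AU; apply: setIS; apply: subset_trans lU.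
apply: (subset_trans (@cylinder_catl _ _)).
by apply: initial_segmentS; do 2 apply: ltnW.
Qed.

(** Already [n = 1] fails: for a segment longer than [k] and long enough to enter [U], dispersion
    would make a whole cylinder the union of two meager sets. *)
Lemma nbhs_not_M_dispersion_point A x (U : set cantor_space) :
  baire_property A ->
  nbhs x U -> meager (~` A `&` U) -> ~ M_dispersion_point A x.
Proof.
move=> Ab /nbhs_cylinder[l lU] AU /(M_dispersion_pointP _ Ab)/(_ _ (ltn0Sn 0)).
move=> [k _ /(_ (maxn l k.+1))]; rewrite leq_max leqnn orbT => /(_ erefl).
move=> /(_ [tuple false])[t At].
pose u := initial_segment x (maxn l k.+1) ++ [tuple false] ++ t.
apply: (@cylinder_not_meager u); apply: meagerS (meagerU At AU).
move=> y ty; case: (pselect (A y)) => Ay; [by left | right; split=> //].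
by apply: lU; move/cylinder_catl: ty; apply: initial_segmentS; exact: leq_maxl.
Qed.

(** * The operator [Phi_M] *)

Lemma Phi_M_sim A : baire_property A -> meager (A `+` Phi_M A).
Proof.
move=> Ab; have /baire_propertyP[G oG AG] := Ab.
have Acb := baire_propertyC Ab.
have Gnd := nowhere_dense_meager (nowhere_dense_closedD (open_closedC oG)).
apply: meagerS (meagerU AG Gnd) => x AxPx.
case: (pselect (G x)) => Gx.
  left; case: AxPx => -[Ax Px]; last by right.
  case: Px; apply: (@nbhs_M_dispersion_point _ _ G) => //.
    exact: open_nbhs_nbhs.
  by apply: meagerS AG => y [nAy Gy]; right.
case: AxPx => -[Ax Px]; first by left; left.
(* On the exterior of [G] the set [A] is locally meager, which rules out density points; so [x] lies
   on the frontier of [G]. *)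
right; split=> // Gcx; apply: (nbhs_not_M_dispersion_point Acb Gcx) Ax.
by apply: meagerS AG => y; rewrite setCK => -[Ay Gy]; left.
Qed.

(** This one-sided form yields both invariance under equivalence and one inclusion for
    intersections. *)
Lemma Phi_M_setYS A B : baire_property A -> baire_property B ->
  meager (A `\` B) -> Phi_M A `<=` Phi_M B.
Proof.
move=> Ab Bb AB x; apply: M_dispersion_pointS; try exact: baire_propertyC.
by apply: meagerS AB => y [nBy /contrapT Ay].
Qed.

Lemma Phi_M_lower_density :
  lower_density_operator (@baire_property cantor_space) (@meager cantor_space)
    Phi_M.
Proof.
have PhiB A : baire_property A -> baire_property (Phi_M A).
  move=> Ab; apply: (baire_property_meager_setY _ Ab).
  by rewrite setYC; exact: Phi_M_sim.
have baireI A B : baire_property A -> baire_property B ->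
    baire_property (A `&` B).
  move=> Ab Bb; rewrite -[A `&` B]setCK setCI.
  by apply/baire_propertyC/baire_propertyU; exact: baire_propertyC.
split=> //.
- exact: baire_property_sigma_algebra.
- exact: meager_sigma_ideal.
- by move=> A; exact: baire_property_meager.
- rewrite -subTset => x _; apply: meager_M_dispersion_point.
  by rewrite setCT; exact: meager0.
- rewrite -subset0 => x; rewrite /Phi_M /M_density_point /= setC0.
  apply: (@nbhs_not_M_dispersion_point _ _ setT).
  + exact/baire_property_open/openT.
  + exact: filterT.
  + by rewrite setCT set0I; exact: meager0.
- move=> A B Ab Bb AB; apply/seteqP; split; apply: Phi_M_setYS => //.
    by apply: meagerS AB; exact: subsetUl.
  by apply: meagerS AB; exact: subsetUr.
- exact: Phi_M_sim.
- move=> A B Ab Bb; apply/seteqP; split=> [|x [Ax Bx]].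
    rewrite subsetI; split; apply: Phi_M_setYS => //; try exact: baireI.
      by apply: meagerS meager0 => y [[]].
    by apply: meagerS meager0 => y [[]].
  (* On complements the intersection becomes a union, where dispersion points combine. *)
  rewrite /Phi_M /M_density_point /= setCI.
  by apply: M_dispersion_pointU => //; exact: baire_propertyC.
Qed.

Lemma Phi_M_Fsigmadelta A : Fsigmadelta (Phi_M A).
Proof.
pose P n k := [set u | forall s : n.-tuple bool, exists t : k.-tuple bool,
  regular_open_kernel (~` A) `&` cylinder (u ++ s ++ t) = set0]
  : set (seq bool).
(* Shifting both indices by one turns the positive parameters [n] and [k] into arbitrary
   naturals. *)
exists (fun n => \bigcup_k \bigcap_(l in [set l | k.+1 < l])
    [set x | P n.+1 k.+1 (initial_segment x l)]) => [n|].
  exists (fun k => \bigcap_(l in [set l | k.+1 < l])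
    [set x | P n.+1 k.+1 (initial_segment x l)]) => // k.
  by apply: closed_bigI => l _; exact: closed_initial_segment.
apply/seteqP; split=> [x Px n _|x Px [//|n] _].
  have [[//|k] _ kP] := Px n.+1 (ltn0Sn n); exists k => // l; exact: kP.
have [k _ kP] := Px n I; exists k.+1 => // l; exact: kP.
Qed.

Theorem theorem5 :
  @lower_density_operator cantor_space (@baire_property cantor_space)
    (@meager cantor_space) Phi_M /\
  (forall A : set cantor_space, @baire_property cantor_space A ->
     @Fsigmadelta cantor_space (Phi_M A)).
Proof.
split; first exact: Phi_M_lower_density.
by move=> A _; exact: Phi_M_Fsigmadelta.
Qed.
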